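(* For every positive integer $n$, the number of partitions $(m_1^{(c_1)},\dots,m_r^{(c_r)})$ of $n$ into parts in two colors ($m_1\le\dots\le m_r$ positive integers with $m_1+\dots+m_r=n$, and $c_i\in\{1,2\}$ the color of the $i$-th part) such that $m_{i+1}-m_i\ge4$ for all $1\le i\le r-1$ and (i) if $c_i=2$ then $m_i\equiv\pm1\pmod 6$ and $m_i>1$ ($i=1,\dots,r$); (ii) if $m_{i+1}-m_i=6$, then $c_{i+1}\ne2$ or $c_i\ne2$; (iii) if $m_{i+1}-m_i=5$, then $c_{i+1}\ne2$ and $c_i\ne2$; (iv) if $m_{i+1}-m_i=4$, then $c_{i+1}\ne2$ and $c_i\ne2$ and $m_{i+1}+m_i\not\equiv\pm4\pmod{12}$ (conditions (ii)–(iv) for all $1\le i\le r-1$), is equal to the number of partitions of $n$ (in one color) into parts congruent to $\pm1$ modulo $6$.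
   Context: A part $m$ of color $c$ is written $m^{(c)}$; the same integer in two different colors counts as two different parts. On the right-hand side, parts may be repeated. *)

(* Defs.v *)
From mathcomp Require Import all_boot.

Set Implicit Arguments.
Unset Strict Implicit.
Unset Printing Implicit Defensive.

Definition is_partition (n : nat) (s : seq nat) : bool :=
  [&& sorted leq s, all (leq 1) s & sumn s == n].

(* m = a or m = -a modulo d, the latter as m + a = 0 since m is a nat *)
Definition congr_pm (a d m : nat) : bool :=
  (m == a %[mod d]) || (m + a == 0 %[mod d]).

(* The part m^(c) is the pair (m, c), with c = 1 or c = 2. *)
Definition part := (nat * nat)%type.

Definition color2_ok (x : part) : bool :=
  (x.2 == 2) ==> congr_pm 1 6 x.1 && (1 < x.1).

(* x is the i-th part and y the (i+1)-st. Truncated subtraction is harmless: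
   only differences >= 4 matter. *)
Definition gap_ok (x y : part) : bool :=
  [&& 4 <= y.1 - x.1,
      (y.1 - x.1 == 6) ==> (y.2 != 2) || (x.2 != 2),
      (y.1 - x.1 == 5) ==> (y.2 != 2) && (x.2 != 2)
    & (y.1 - x.1 == 4) ==>
        [&& y.2 != 2, x.2 != 2 & ~~ congr_pm 4 12 (y.1 + x.1)]].

Definition is_two_color_partition (n : nat) (p : seq part) : bool :=
  [&& is_partition n (map fst p),
      all (fun x => (x.2 == 1) || (x.2 == 2)) p,
      all color2_ok p
    & sorted gap_ok p].

Definition is_pm1_mod6_partition (n : nat) (s : seq nat) : bool :=
  is_partition n s && all (congr_pm 1 6) s.

(* Partitions of n have at most n parts, all at most n, so they can be counted
   inside the finite types of sequences with these bounds. *)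
Lemma is_partition_bound n s :
  is_partition n s -> (size s <= n) && all (fun m => m <= n) s.
Proof.
case/and3P=> _ + /eqP<- {n}; elim: s => //= m s IHs /andP[m_gt0 /IHs].
case/andP=> le_s /allP le_m; rewrite -add1n leq_add //= leq_addr /=.
by apply/allP=> k /le_m /leq_trans; apply; rewrite leq_addl.
Qed.

Definition two_color_partitions (n : nat) :
    {set n.-bseq ('I_n.+1 * 'I_3)} :=
  [set p : n.-bseq ('I_n.+1 * 'I_3) |
     is_two_color_partition n [seq (val x.1, val x.2) | x <- p]].

Definition pm1_mod6_partitions (n : nat) : {set n.-bseq 'I_n.+1} :=
  [set s : n.-bseq 'I_n.+1 | is_pm1_mod6_partition n (map val s)].

(* Main.v *)
Require Import Defs.
From mathcomp Require Import all_boot all_order all_algebra.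
From mathcomp Require Import zify ring.

(* Give the letters a, b, ab to the parts of color 1 congruent to 1, 2, 0
   modulo 3, and a^2, b^2 to the parts of color 2 congruent to 5, 1 modulo 6.
   With letters, the generating function of the two-color partitions is
   F(a, b) = prod_j (1 + a q^(3j+1)) (1 + b q^(3j+2)): this follows by iterating
   F(a, b) = (1 + a q) F(b q, a q^2).  That functional equation is the limit of
   finite identities, proved by induction on k: if H_M(a, b) counts the
   partitions whose parts of color 1 are <= M and of color 2 are <= M - 2, and
   H'_M = H_M(b q, a q^2), then
     H_(6k+1) = (1 + a q) H'_(6k-1),   H_(6k+3) = (1 + a q) H'_(6k+1),
     H_(6k+5) = H'_(6k+5) + a q (1 - q^(6k+6)) H'_(6k+1).
   At a = b = 1 the product enumerates partitions into distinct parts prime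
   to 3, and Euler's argument turns it into parts congruent to +-1 modulo 6. *)

Set Implicit Arguments.
Unset Strict Implicit.
Unset Printing Implicit Defensive.

Import GRing.Theory.

(** * Valid parts and enumeration of two-color partitions by level *)

Definition valid_part (x : part) : bool :=
  [&& 0 < x.1, (x.2 == 1) || (x.2 == 2) & color2_ok x].

(* A part of color 2 behaves like a part of color 1 larger by 2: the admissible
   predecessors of a valid part x are exactly those of level at most cap x. *)
Definition level (x : part) : nat := x.1 + (x.2 == 2).*2.

Definition cap (x : part) : nat :=
  x.1 - (if x.2 == 2 then 6 else 4 + (x.1 %% 6 \in [:: 0; 4])).

(** Two parts of color 1 at difference 4 have sum [2m - 4], where [m] is the larger; this is +-4
    modulo 12 exactly when [m] is 0 or 4 modulo 6, hence the extra 1 in [cap]. If color 2 occurs,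
    the least difference is 6, or 7 when both have color 2. Where levels ask for one more, the lost
    difference cannot occur, as parts of color 2 are +-1 modulo 6. *)
Lemma gap_ok_level x y :
  valid_part x -> valid_part y -> gap_ok y x = (level y <= cap x).
Proof.
case: x => m c; case: y => m' c'.
rewrite /valid_part /gap_ok /level /cap /color2_ok /congr_pm /= !inE.
case/and3P=> m_gt0 /orP[]/eqP-> /= hm /and3P[m'_gt0 /orP[]/eqP-> /= hm'];
  by lia.
Qed.

(* The sequences list the largest part first. *)
Fixpoint level_le (M : nat) : seq (seq part) :=
  if M is M'.+1 then
    level_le M'
    ++ [seq (M, 1) :: s | s <- level_le (M' - (3 + (M %% 6 \in [:: 0; 4])))]
    ++ (if color2_ok (M'.-1, 2) then
          [seq (M'.-1, 2) :: s | s <- level_le (M' - 7)] else [::])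
  else [:: [::]].

(** Folds the bounds of [level_le] back into [cap]; the definition subtracts from the predecessor to
    make the recursion structural. *)
Lemma level_leS M :
  level_le M.+1 = level_le M
    ++ [seq (M.+1, 1) :: s | s <- level_le (cap (M.+1, 1))]
    ++ (if color2_ok (M.-1, 2) then
          [seq (M.-1, 2) :: s | s <- level_le (cap (M.-1, 2))] else [::]).
Proof. by rewrite /cap /= -subn1 -subnDA. Qed.

Definition valid (s : seq part) : bool :=
  all valid_part s && sorted (fun x y => gap_ok y x) s.

Lemma mem_map_cons (T : eqType) (x y : T) s (l : seq (seq T)) :
  (x :: s \in [seq y :: t | t <- l]) = (x == y) && (s \in l).
Proof.
apply/mapP/andP => [[t t_l [-> ->]]|[/eqP-> s_l]]; first by rewrite eqxx.
by exists s.
Qed.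

Definition head_le (M : nat) (s : seq part) : bool :=
  if s is x :: _ then level x <= M else true.

Lemma valid_cons x s :
  valid (x :: s) = [&& valid_part x, valid s & head_le (cap x) s].
Proof.
rewrite /valid /head_le /=; case: s => [|y s] /=; first by rewrite !andbT.
case: (boolP (valid_part x)) => //= vx; case: (boolP (valid_part y)) => //= vy.
by rewrite gap_ok_level // [RHS]andbC andbCA.
Qed.

Lemma mem_level_le M s : (s \in level_le M) = valid s && head_le M s.
Proof.
elim/ltn_ind: M s => -[_ [|x s]|M IH [|x s]] //.
- rewrite valid_cons inE; symmetry; apply/negP => /andP[/andP[/and3P[]]].
  by rewrite /= /level; lia.
- by rewrite level_leS mem_cat IH.
rewrite level_leS !mem_cat IH // mem_map_cons.
rewrite (fun_if (fun l => x :: s \in l)) in_nil mem_map_cons.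
rewrite !IH; try by rewrite /cap /=; lia.
rewrite valid_cons /= -/head_le; case: (valid s);
  last by rewrite !andbF if_same.
rewrite /= -andbA.
case: x => m c; rewrite !xpair_eqE /=.
have [->|c1] := eqVneq c 1; last have [->|c2] := eqVneq c 2.
- rewrite /level /= !andbF if_same !andbT orbF addn0 [in RHS]leq_eqVlt ltnS.
  rewrite /valid_part /color2_ok /=.
  have [->|_] := eqVneq m M.+1; first by rewrite /= ltnn !andbF !andbT.
  by rewrite /= orbF andbA.
- rewrite !andbT andbF orFb /level /= [in RHS]leq_eqVlt ltnS.
  have [mM|mM] := eqVneq (m + 2) M.+1.
    have -> : m = M.-1 by lia.
    have -> : (M.-1 + 2 <= M) = false by lia.
    rewrite eqxx /= !andbF andbT /valid_part /=.
    case: ifP => cc; rewrite ?andbF //=.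
    by suff -> : 0 < M.-1 by []; move: cc; rewrite /color2_ok /=; lia.
  rewrite -andbA; case: (boolP (color2_ok _)) => cc; last by rewrite orbF.
  (* Equality could only come from truncation at [M = 0], but [color2_ok] rejects the part 0. *)
  suff -> : (m == M.-1) = false by rewrite orbF.
  by move: cc; rewrite /color2_ok /=; lia.
by rewrite /valid_part /= (negbTE c1) (negbTE c2) !andbF /= if_same.
Qed.

Lemma uniq_level_le M : uniq (level_le M).
Proof.
elim/ltn_ind: M => -[|M IH] //.
have cons_inj (x : part) : injective (cons x) by move=> s t [].
have notin x N : level x = M.+1 ->
    ~~ has (mem (level_le M)) [seq x :: s | s <- level_le N].
  move=> lx; apply/hasPn => _ /mapP[s _ ->] /=.
  by rewrite mem_level_le /head_le lx ltnn andbF.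
rewrite level_leS !cat_uniq has_cat negb_or notin /level /= ?addn0 //.
rewrite !map_inj_uniq // !IH /=; try by rewrite /cap /=; lia.
case: ifP => [cc|_] //=; rewrite notin /=; last first.
  by move: cc; rewrite /level /color2_ok /=; lia.
rewrite map_inj_uniq // IH /=; try by rewrite /cap /=; lia.
rewrite andbT; apply/hasPn => _ /mapP[s _ ->] /=.
by rewrite mem_map_cons xpair_eqE andbF.
Qed.

(** * Weighted generating functions and their recurrences *)

Local Open Scope ring_scope.

Definition letters (R : comNzRingType) (a b : R) (x : part) : R :=
  if (x.2 == 2)%N then if (x.1 %% 3 == 2)%N then a ^+ 2 else b ^+ 2
  else if (x.1 %% 3 == 0)%N then a * b
  else if (x.1 %% 3 == 1)%N then a else b.

Definition wgf (R : comNzRingType) (a b q : R) (M : nat) : R :=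
  \sum_(s <- level_le M) \prod_(x <- s) (letters a b x * q ^+ x.1).

Section Recurrence.

Variables (R : comNzRingType) (a b q : R).

Lemma wgf0 : wgf a b q 0 = 1.
Proof. by rewrite /wgf big_seq1 big_nil. Qed.

Lemma wgfS M :
  wgf a b q M.+1 = wgf a b q M
    + letters a b (M.+1, 1%N) * q ^+ M.+1 * wgf a b q (cap (M.+1, 1%N))
    + (if color2_ok (M.-1, 2%N) then
         letters a b (M.-1, 2%N) * q ^+ M.-1 * wgf a b q (cap (M.-1, 2%N))
       else 0).
Proof.
have cons_sum (x : part) l :
    \sum_(s <- [seq x :: s | s <- l]) \prod_(y <- s) (letters a b y * q ^+ y.1)
    = letters a b x * q ^+ x.1
      * \sum_(s <- l) \prod_(y <- s) (letters a b y * q ^+ y.1).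
  by rewrite big_map big_distrr; apply: eq_bigr => s _; rewrite big_cons.
rewrite {1}/wgf level_leS !big_cat /= cons_sum addrA; congr (_ + _).
by case: ifP => _; rewrite ?cons_sum ?big_nil.
Qed.

Lemma letters1 m :
  letters a b (m, 1%N) =
    if (m %% 3 == 0)%N then a * b else if (m %% 3 == 1)%N then a else b.
Proof. by []. Qed.

Lemma letters2 m :
  letters a b (m, 2%N) = if (m %% 3 == 2)%N then a ^+ 2 else b ^+ 2.
Proof. by []. Qed.

(** This and the next five lemmas spell out [wgfS] by residue modulo 6. Color 2 contributes only at
    levels [6k + 7] and [6k + 9], through the parts [6k + 5] and [6k + 7]. At [k = 0] the level
    [(6 * k).-1] is 0, as [cap] requires. *)
Lemma wgf_add4 k :
  wgf a b q (6 * k + 4) = wgf a b q (6 * k + 3)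
    + a * q ^+ (6 * k + 4) * wgf a b q (6 * k).-1.
Proof.
rewrite addnS wgfS letters1 letters2.
have -> : (color2_ok ((6 * k + 3)%N.-1, 2%N)) = false.
  by rewrite /color2_ok /congr_pm /=; lia.
have -> : ((6 * k + 3)%N.+1 %% 3 = 1)%N by lia.
have -> : cap ((6 * k + 3)%N.+1, 1%N) = (6 * k).-1%N.
  by rewrite /cap /= !inE; lia.
by rewrite /= addr0.
Qed.

Lemma wgf_add5 k :
  wgf a b q (6 * k + 5) = wgf a b q (6 * k + 4)
    + b * q ^+ (6 * k + 5) * wgf a b q (6 * k + 1).
Proof.
rewrite addnS wgfS letters1 letters2.
have -> : (color2_ok ((6 * k + 4)%N.-1, 2%N)) = false.
  by rewrite /color2_ok /congr_pm /=; lia.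
have -> : ((6 * k + 4)%N.+1 %% 3 = 2)%N by lia.
have -> : cap ((6 * k + 4)%N.+1, 1%N) = (6 * k + 1)%N.
  by rewrite /cap /= !inE; lia.
by rewrite /= addr0.
Qed.

Lemma wgf_add6 k :
  wgf a b q (6 * k + 6) = wgf a b q (6 * k + 5)
    + a * b * q ^+ (6 * k + 6) * wgf a b q (6 * k + 1).
Proof.
rewrite addnS wgfS letters1 letters2.
have -> : (color2_ok ((6 * k + 5)%N.-1, 2%N)) = false.
  by rewrite /color2_ok /congr_pm /=; lia.
have -> : ((6 * k + 5)%N.+1 %% 3 = 0)%N by lia.
have -> : cap ((6 * k + 5)%N.+1, 1%N) = (6 * k + 1)%N.
  by rewrite /cap /= !inE; lia.
by rewrite /= addr0.
Qed.

Lemma wgf_add7 k :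
  wgf a b q (6 * k + 7) = wgf a b q (6 * k + 6)
    + a * q ^+ (6 * k + 7) * wgf a b q (6 * k + 3)
    + a ^+ 2 * q ^+ (6 * k + 5) * wgf a b q (6 * k).-1.
Proof.
rewrite addnS wgfS letters1 letters2.
have -> : (color2_ok ((6 * k + 6)%N.-1, 2%N)) = true.
  by rewrite /color2_ok /congr_pm /=; lia.
have -> : ((6 * k + 6)%N.+1 %% 3 = 1)%N by lia.
have -> : cap ((6 * k + 6)%N.+1, 1%N) = (6 * k + 3)%N.
  by rewrite /cap /= !inE; lia.
have -> : ((6 * k + 6)%N.-1 %% 3 = 2)%N by lia.
have -> : cap ((6 * k + 6)%N.-1, 2%N) = (6 * k).-1%N by rewrite /cap /=; lia.
by have -> : ((6 * k + 6)%N.-1 = 6 * k + 5)%N by lia.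
Qed.

Lemma wgf_add8 k :
  wgf a b q (6 * k + 8) = wgf a b q (6 * k + 7)
    + b * q ^+ (6 * k + 8) * wgf a b q (6 * k + 4).
Proof.
rewrite addnS wgfS letters1 letters2.
have -> : (color2_ok ((6 * k + 7)%N.-1, 2%N)) = false.
  by rewrite /color2_ok /congr_pm /=; lia.
have -> : ((6 * k + 7)%N.+1 %% 3 = 2)%N by lia.
have -> : cap ((6 * k + 7)%N.+1, 1%N) = (6 * k + 4)%N.
  by rewrite /cap /= !inE; lia.
by rewrite /= addr0.
Qed.

Lemma wgf_add9 k :
  wgf a b q (6 * k + 9) = wgf a b q (6 * k + 8)
    + a * b * q ^+ (6 * k + 9) * wgf a b q (6 * k + 5)
    + b ^+ 2 * q ^+ (6 * k + 7) * wgf a b q (6 * k + 1).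
Proof.
rewrite addnS wgfS letters1 letters2.
have -> : (color2_ok ((6 * k + 8)%N.-1, 2%N)) = true.
  by rewrite /color2_ok /congr_pm /=; lia.
have -> : ((6 * k + 8)%N.+1 %% 3 = 0)%N by lia.
have -> : cap ((6 * k + 8)%N.+1, 1%N) = (6 * k + 5)%N.
  by rewrite /cap /= !inE; lia.
have -> : ((6 * k + 8)%N.-1 %% 3 = 1)%N by lia.
have -> : cap ((6 * k + 8)%N.-1, 2%N) = (6 * k + 1)%N by rewrite /cap /=; lia.
by have -> : ((6 * k + 8)%N.-1 = 6 * k + 7)%N by lia.
Qed.

Lemma wgf1 : wgf a b q 1 = 1 + a * q.
Proof. by rewrite wgfS /= !wgf0 /letters /= addr0 mulr1. Qed.

Lemma wgf3 : wgf a b q 3 = 1 + a * q + b * q ^+ 2 + a * b * q ^+ 3.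
Proof. by rewrite !wgfS /= /cap /= !wgf0 /letters /= !addr0 !mulr1. Qed.

End Recurrence.

(** * Elimination of even levels and the finite functional equation *)

Section OddLevels.

Variables (R : comNzRingType) (a b q : R).

Local Notation H := (wgf a b q).

Lemma wgf_odd5 k :
  H (6 * k + 5) = H (6 * k + 3) + a * q ^+ (6 * k + 4) * H (6 * k).-1
                  + b * q ^+ (6 * k + 5) * H (6 * k + 1).
Proof. by rewrite wgf_add5 wgf_add4. Qed.

(** Expanding [a q H_(6k+5)] by [wgf_odd5] yields the terms in [H_(6k+1)] and [H_(6k-1)] of the
    recurrence, leaving only a multiple of [H_(6k+3)]. *)
Lemma wgf_odd7 k :
  H (6 * k + 7) = (1 + a * q) * H (6 * k + 5)
                  - a * q * (1 - q ^+ (6 * k + 6)) * H (6 * k + 3).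
Proof.
rewrite wgf_add7 wgf_add6 mulrDl mul1r {3}wgf_odd5 !exprD; ring.
Qed.

(** The level [6k + 4] is removed by [wgf_add5], whose term in [H_(6k+1)] supplies the factor
    [1 - q^(6k+6)]. *)
Lemma wgf_odd9 k :
  H (6 * k + 9) = H (6 * k + 7)
    + b * q ^+ (6 * k + 8) * (1 + a * q) * H (6 * k + 5)
    + b ^+ 2 * q ^+ (6 * k + 7) * (1 - q ^+ (6 * k + 6)) * H (6 * k + 1).
Proof.
(* The split isolates the copy of [H_(6k+5)] to be expanded. *)
have -> : b * q ^+ (6 * k + 8) * (1 + a * q) * H (6 * k + 5)
  = b * q ^+ (6 * k + 8) * H (6 * k + 5)
    + b * q ^+ (6 * k + 8) * (a * q) * H (6 * k + 5) by ring.
by rewrite wgf_add9 wgf_add8 {2}wgf_add5 !exprD; ring.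
Qed.

Lemma wgf_odd11 k :
  H (6 * k + 11) = H (6 * k + 9) + a * q ^+ (6 * k + 10) * H (6 * k + 5)
                   + b * q ^+ (6 * k + 11) * H (6 * k + 7).
Proof.
have e r : (6 * k.+1 + r = 6 * k + (6 + r))%N by lia.
have := wgf_odd5 k.+1.
have -> : ((6 * k.+1).-1 = 6 * k + 5)%N by lia.
by rewrite !e.
Qed.

End OddLevels.

Lemma wgf_shift (R : comNzRingType) (a b q : R) k :
  let H := wgf a b q in let H' := wgf (b * q) (a * q ^+ 2) q in
  [/\ H (6 * k + 1)%N = (1 + a * q) * H' (6 * k).-1%N,
      H (6 * k + 3)%N = (1 + a * q) * H' (6 * k + 1)%N
    & H (6 * k + 5)%N
      = H' (6 * k + 5)%N + a * q * (1 - q ^+ (6 * k + 6)) * H' (6 * k + 1)%N].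
Proof.
move=> H H'; elim: k => [|k [IH1 IH3 IH5]].
  have e1 : H 1 = (1 + a * q) * H' 0 by rewrite /H /H' wgf0 wgf1 mulr1.
  have e3 : H 3 = (1 + a * q) * H' 1 by rewrite /H /H' wgf3 wgf1; ring.
  split; rewrite ?muln0 //.
  have := wgf_odd5 a b q 0; have := wgf_odd5 (b * q) (a * q ^+ 2) q 0.
  rewrite !muln0 !add0n /= -/H -/H' e1 e3 => -> ->.
  by rewrite /H /H' !wgf0 wgf1 wgf3; ring.
have e r : (6 * k.+1 + r = 6 * k + (6 + r))%N by lia.
have -> : ((6 * k.+1).-1 = 6 * k + 5)%N by lia.
rewrite (e 1) (e 3) (e 5) (e 6).
(* The correction term of [IH5] cancels against the last term of [wgf_odd7]. *)
have E7 : H (6 * k + 7)%N = (1 + a * q) * H' (6 * k + 5)%N.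
  by rewrite /H wgf_odd7 -/H IH3 IH5; ring.
have E9 : H (6 * k + 9)%N = (1 + a * q) * H' (6 * k + 7)%N.
  (* Every term carries [1 + a q]; the cofactor is [wgf_odd7] at the shifted letters, with
     [wgf_odd5] giving [H'_(6k+5) - H'_(6k+3)]. *)
  rewrite /H wgf_odd9 -/H E7 IH1 IH5 /H' wgf_odd7 wgf_odd5 !exprD; ring.
split=> //; rewrite -[(6 + 5)%N]/11%N -[(6 + 6)%N]/12%N -[(6 + 1)%N]/7%N.
rewrite /H wgf_odd11 -/H E9 E7 IH5 /H' wgf_odd11 wgf_odd9 !exprD.
by ring.
Qed.

(** * Power series, as polynomials modulo powers of ['X] *)

Definition eqX (N : nat) (x y : {poly rat}) : Prop := 'X^N %| x - y.

Lemma eqX_refl N x : eqX N x x.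
Proof. by rewrite /eqX subrr dvdp0. Qed.

Lemma eqX_sym N x y : eqX N x y -> eqX N y x.
Proof. by rewrite /eqX -opprB dvdpNr. Qed.

Lemma eqX_trans N y x z : eqX N x y -> eqX N y z -> eqX N x z.
Proof. by move=> xy yz; rewrite /eqX -[x](subrK y) -addrA dvdp_add. Qed.

Lemma eqXM N x x' y y' : eqX N x x' -> eqX N y y' -> eqX N (x * y) (x' * y').
Proof.
move=> xx yy; rewrite /eqX.
have -> : x * y - x' * y' = (x - x') * y + x' * (y - y') by ring.
by apply: dvdp_add; [exact: dvdp_mulr | exact: dvdp_mull].
Qed.

Lemma eqXMl N x y y' : eqX N y y' -> eqX N (x * y) (x * y').
Proof. exact: eqXM (eqX_refl _ _). Qed.

Lemma eqX_leq N N' x y : (N <= N')%N -> eqX N' x y -> eqX N x y.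
Proof. by move=> le_N; apply: dvdp_trans; rewrite dvdp_exp2l. Qed.

Lemma eqXD N x y : 'X^N %| y -> eqX N (x + y) x.
Proof. by rewrite /eqX addrC addKr. Qed.

Lemma eqX_coef N x y i : (i < N)%N -> eqX N x y -> x`_i = y`_i.
Proof.
move=> lt_iN /dvdpP[r e]; apply/eqP; rewrite -subr_eq0 -coefB e.
by rewrite coefMXn lt_iN.
Qed.

(** A polynomial with nonzero constant term is coprime to ['X^N]. *)
Lemma eqX_cancel N p x y : p.[0] != 0 -> eqX N (p * x) (p * y) -> eqX N x y.
Proof.
move=> p0; rewrite /eqX -mulrBr Gauss_dvdpr //.
by rewrite coprimep_expl // coprimep_sym coprimepX rootE.
Qed.

(** * Limit of the functional equation and the product formula *)

Lemma dvdp_letters N (a b : {poly rat}) x :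
  'X^N %| a -> 'X^N %| b -> 'X^N %| letters a b x.
Proof.
move=> a0 b0; rewrite /letters.
by do !case: ifP => _ //; rewrite dvdp_mulr.
Qed.

(** Every nonempty sequence carries a letter, so only the empty one survives. *)
Lemma wgf_eqX1 N (a b : {poly rat}) M :
  'X^N %| a -> 'X^N %| b -> eqX N (wgf a b 'X M) 1.
Proof.
move=> a0 b0; elim: M => [|M IH]; first by rewrite wgf0; apply: eqX_refl.
rewrite wgfS -addrA; apply: eqX_trans (IH); apply: eqXD.
by apply: dvdp_add; last case: ifP => _; rewrite ?dvdp0 // -mulrA dvdp_mulr //;
  apply: dvdp_letters.
Qed.

(** A sequence of level above [M] starts with a part at least [M - 1], a bound attained in color
    2. *)
Lemma wgf_stable (a b : {poly rat}) M j :
  eqX M.-1 (wgf a b 'X (M + j)) (wgf a b 'X M).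
Proof.
elim: j => [|j IH]; first by rewrite addn0; apply: eqX_refl.
rewrite addnS wgfS -addrA; apply: eqX_trans (IH); apply: eqXD.
by apply: dvdp_add; last case: ifP => _; rewrite ?dvdp0 // -mulrA mulrCA;
  rewrite dvdp_mulr // dvdp_exp2l //; lia.
Qed.

Lemma wgf_stepX k (a b : {poly rat}) :
  eqX k (wgf a b 'X (6 * k + 1))
        ((1 + a * 'X) * wgf (b * 'X) (a * 'X^2) 'X (6 * k + 1)).
Proof.
have [-> _ _] := wgf_shift a b 'X k; apply/eqXMl/eqX_sym.
(* Levels [6k - 1] and [6k + 1] agree modulo ['X^(6k-2)]; the coarser precision [k] is enough, as
   [k] is arbitrary. *)
apply: (@eqX_leq _ (6 * k).-2); first by lia.
case: k => [|k]; first by rewrite /eqX dvd1p.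
have -> : (6 * k.+1 + 1 = (6 * k.+1).-1 + 2)%N by lia.
exact: wgf_stable.
Qed.

Definition distinct_prod (j : nat) : {poly rat} :=
  \prod_(i < j) ((1 + 'X^(3 * i + 1)) * (1 + 'X^(3 * i + 2))).

(** Two shifts turn [(a, b)] into [(a q^3, b q^3)], so each pair of steps restores equal letters and
    contributes two factors. *)
Lemma wgf_prodX k j :
  eqX k (wgf 1 1 'X (6 * k + 1))
        (distinct_prod j * wgf 'X^(3 * j) 'X^(3 * j) 'X (6 * k + 1)).
Proof.
elim: j => [|j IH].
  by rewrite muln0 /distinct_prod big_ord0 mul1r; apply: eqX_refl.
apply: eqX_trans IH _; rewrite {2}/distinct_prod big_ord_recr /= -mulrA.
apply: eqXMl; apply: eqX_trans (wgf_stepX _ _ _) _.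
rewrite -mulrA -!exprD -exprSr -addn1; apply: eqXMl.
apply: eqX_trans (wgf_stepX _ _ _) _.
rewrite -!exprD -!exprSr.
have -> : (3 * j + 1).+1 = (3 * j + 2)%N by lia.
have -> : (3 * j + 2).+1 = (3 * j.+1)%N by lia.
have -> : (3 * j + 1 + 2)%N = (3 * j.+1)%N by lia.
exact: eqX_refl.
Qed.

(** After [2k] pairs of steps the letters are ['X^(6k)], which vanish modulo ['X^k]; [2k] blocks of
    length 3 make [k] full periods modulo 6. *)
Lemma wgf_distinct k : eqX k (wgf 1 1 'X (6 * k + 1)) (distinct_prod (2 * k)).
Proof.
apply: eqX_trans (wgf_prodX k (2 * k)) _; rewrite -[X in eqX _ _ X]mulr1.
by apply/eqXMl/wgf_eqX1; rewrite dvdp_exp2l //; lia.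
Qed.

(** * Euler's argument, on reciprocals of generating functions *)

Definition pm1_prod (M : nat) : {poly rat} :=
  \prod_(m < M.+1 | congr_pm 1 6 m) (1 - 'X^m).

Lemma pm1_prod0 : pm1_prod 0 = 1.
Proof. by rewrite /pm1_prod big_mkcond big_ord1. Qed.

Lemma pm1_prodS M :
  pm1_prod M.+1 =
    pm1_prod M * (if congr_pm 1 6 M.+1 then 1 - 'X^(M.+1) else 1).
Proof. by rewrite /pm1_prod big_mkcond big_ord_recr /= -big_mkcond. Qed.

Definition even_prod (j : nat) : {poly rat} :=
  \prod_(i < j) ((1 - 'X^(6 * i + 2)) * (1 - 'X^(6 * i + 4))).

(** Integers prime to 3 are either odd, hence +-1 modulo 6, or even, hence +-2. *)
Lemma pm1_prod_split k :
  \prod_(i < 2 * k) ((1 - 'X^(3 * i + 1)) * (1 - 'X^(3 * i + 2)))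
    = pm1_prod (6 * k) * even_prod k.
Proof.
elim: k => [|k IH].
  by rewrite pm1_prod0 /even_prod !big_ord0 mulr1.
have -> : (2 * k.+1 = (2 * k).+2)%N by lia.
rewrite !big_ord_recr /= IH {2}/even_prod big_ord_recr /= -/(even_prod k).
have -> : (6 * k.+1 = (6 * k).+4.+2)%N by lia.
have c r : congr_pm 1 6 (r + 6 * k)%N = congr_pm 1 6 r.
  by rewrite /congr_pm; lia.
rewrite !pm1_prodS (c 1%N) (c 2%N) (c 3%N) (c 4%N) (c 5%N) (c 6%N) /= !mulr1.
have -> : (3 * (2 * k) = 6 * k)%N by lia.
have -> : (3 * (2 * k).+1 = 6 * k + 3)%N by lia.
have -> : (6 * k).+1 = (6 * k + 1)%N by lia.
have -> : (6 * k + 1).+4 = (6 * k + 5)%N by lia.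
rewrite -[(6 * k + 3 + 1)%N]addnA -[(6 * k + 3 + 2)%N]addnA.
move: (1 - 'X^(6 * k + 1)) (1 - 'X^(6 * k + 2)) (1 - 'X^(6 * k + (3 + 1))).
move: (1 - 'X^(6 * k + (3 + 2))) => t u v w; ring.
Qed.

(** Multiplied by [even_prod k], the left side becomes the product of
    [(1 - 'X^m)(1 + 'X^m) = 1 - 'X^(2m)] over [m] up to [6k] prime to 3. This is
    [even_prod (2 * k)], whose additional factors are 1 modulo ['X^(6k)]; then [even_prod k]
    cancels. *)
Lemma pm1_prod_distinct k :
  eqX (6 * k) (pm1_prod (6 * k) * distinct_prod (2 * k)) 1.
Proof.
have even_stable j : eqX (6 * k) (even_prod (k + j)) (even_prod k).
  elim: j => [|j IH]; first by rewrite addn0; apply: eqX_refl.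
  apply: eqX_trans IH; rewrite addnS /even_prod big_ord_recr /=.
  rewrite -[X in eqX _ _ X]mulr1; apply: eqXMl; rewrite /eqX.
  set u := 'X^(_ + 2); set v := 'X^(_ + 4).
  have -> : (1 - u) * (1 - v) - 1 = u * (v - 1) - v by ring.
  by rewrite dvdp_sub ?dvdp_mulr // dvdp_exp2l //; lia.
have ev0 : (even_prod k).[0] != 0.
  rewrite horner_prod; apply/prodf_neq0 => i _.
  by rewrite !hornerE addn2 addn4 !exprS !mul0r !subr0 mulr1 oner_neq0.
apply: (eqX_cancel ev0); rewrite mulr1 mulrA [even_prod k * _]mulrC.
rewrite -pm1_prod_split /distinct_prod -big_split /=.
apply: eqX_trans (even_stable k); rewrite addnn -mul2n.
rewrite (_ : \prod_(i < _) _ = even_prod (2 * k)); first exact: eqX_refl.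
apply: eq_bigr => i _.
have -> : (6 * i + 2 = (3 * i + 1) * 2)%N by lia.
have -> : (6 * i + 4 = (3 * i + 2) * 2)%N by lia.
by rewrite !exprM; ring.
Qed.

Lemma pm1_prod_neq0 M : (pm1_prod M).[0] != 0.
Proof.
elim: M => [|M IH]; first by rewrite pm1_prod0 hornerE oner_eq0.
rewrite pm1_prodS hornerM mulf_neq0 //.
by case: ifP => _; rewrite !hornerE ?expr0n ?subr0 oner_eq0.
Qed.

(** * Enumeration of partitions into parts +-1 modulo 6 *)

(* At most f parts, all at most M, the largest part first. *)
Fixpoint pm1_le (f : nat) : nat -> seq (seq nat) :=
  fix pm1_le_f (M : nat) : seq (seq nat) :=
    match f, M with
    | f'.+1, M'.+1 =>
        pm1_le_f M'
        ++ (if congr_pm 1 6 M then [seq M :: s | s <- pm1_le f' M] else [::])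
    | _, _ => [:: [::]]
    end.

Lemma pm1_leS f M :
  pm1_le f.+1 M.+1 = pm1_le f.+1 M
    ++ (if congr_pm 1 6 M.+1 then [seq M.+1 :: s | s <- pm1_le f M.+1]
        else [::]).
Proof. by []. Qed.

Lemma pm1_lef0 f : pm1_le f 0 = [:: [::]].
Proof. by case: f. Qed.

Lemma pm1_le0M M : pm1_le 0 M = [:: [::]].
Proof. by case: M. Qed.

Lemma mem_pm1_le f M s :
  (s \in pm1_le f M) =
    [&& (size s <= f)%N, all (congr_pm 1 6) s, sorted geq s
      & (head 0 s <= M)%N].
Proof.
elim: f M s => [|f IHf] M s.
  by rewrite pm1_le0M; case: s.
elim: M s => [|M IHM] [|m s]; rewrite ?pm1_lef0 //.
- rewrite inE; apply/esym/negP => /and4P[_ /= /andP[c _] _].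
  by rewrite leqn0 => /eqP m0; rewrite m0 in c.
- by rewrite pm1_leS mem_cat IHM.
rewrite pm1_leS mem_cat IHM (fun_if (fun l => m :: s \in l)) in_nil.
rewrite mem_map_cons IHf /= [in RHS](leq_eqVlt m) !ltnS.
have [->|_] := eqVneq m M.+1; last by rewrite /= if_same orbF.
have -> : path geq M.+1 s = sorted geq s && (head 0 s <= M.+1)%N.
  by case: s => //= x s; rewrite andbC.
by rewrite ltnn !andbF /= andbT; case: ifP => _; rewrite ?andbF ?andbT.
Qed.

Lemma uniq_pm1_le f M : uniq (pm1_le f M).
Proof.
elim: f M => [|f IHf] M; first by rewrite pm1_le0M.
elim: M => [|M IHM]; first by rewrite pm1_lef0.
rewrite pm1_leS cat_uniq IHM /=; case: ifP => //= _.
rewrite map_inj_uniq ?IHf ?andbT; last by move=> s t [].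
apply/hasPn => _ /mapP[s _ ->].
by rewrite -/(pm1_le f.+1 M) mem_pm1_le /= ltnn !andbF.
Qed.

Definition pm1_gf (f M : nat) : {poly rat} :=
  \sum_(s <- pm1_le f M) 'X^(sumn s).

Lemma pm1_gfS f M :
  pm1_gf f.+1 M.+1 = pm1_gf f.+1 M
    + (if congr_pm 1 6 M.+1 then 'X^(M.+1) * pm1_gf f M.+1 else 0).
Proof.
rewrite /pm1_gf pm1_leS big_cat; congr (_ + _).
case: ifP => _; last by rewrite big_nil.
by rewrite big_map mulr_sumr; apply: eq_bigr => s _; rewrite -exprD.
Qed.

(** The additional sequences have [f + 1] positive parts, so their sum is at least [f + 1]. *)
Lemma pm1_gf_stable f M : eqX f.+1 (pm1_gf f.+1 M) (pm1_gf f M).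
Proof.
elim: f M => [|f IHf] M.
  have gf0 N : pm1_gf 0 N = 1 by rewrite /pm1_gf pm1_le0M big_seq1.
  rewrite gf0; elim: M => [|M IHM].
    by rewrite /pm1_gf pm1_lef0 big_seq1; exact: eqX_refl.
  apply: eqX_trans IHM; rewrite pm1_gfS; apply: eqXD.
  by case: ifP => _; rewrite ?dvdp0 // expr1 exprS -mulrA dvdp_mulr.
elim: M => [|M IHM].
  by rewrite /pm1_gf !pm1_lef0; exact: eqX_refl.
rewrite /eqX (pm1_gfS f M) (pm1_gfS f.+1 M) opprD addrACA.
apply: dvdp_add => //.
case: ifP => _; last by rewrite subrr dvdp0.
rewrite -mulrBr exprS; apply: dvdp_mul; last exact: IHf.
by rewrite exprS dvdp_mulr.
Qed.

(** By [pm1_gfS], each factor [1 - 'X^m] lowers the bound on the parts by one; this moves [f] to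
    [f + 1], which stability undoes. *)
Lemma pm1_gf_prod f M : eqX f.+1 (pm1_prod M * pm1_gf f M) 1.
Proof.
elim: M => [|M IH].
  rewrite pm1_prod0 mul1r /pm1_gf pm1_lef0 big_seq1; exact: eqX_refl.
apply: eqX_trans IH; rewrite pm1_prodS -mulrA; apply: eqXMl.
apply: (@eqX_trans _ (pm1_gf f.+1 M)); last exact: pm1_gf_stable.
have /eqX_sym := pm1_gf_stable f M.+1; rewrite pm1_gfS.
case: ifP => _ h; last by rewrite mul1r -[X in eqX _ _ X]addr0.
rewrite /eqX in h *.
by have -> : (1 - 'X^(M.+1)) * pm1_gf f M.+1 - pm1_gf f.+1 M
  = pm1_gf f M.+1 - (pm1_gf f.+1 M + 'X^(M.+1) * pm1_gf f M.+1) by ring.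
Qed.

(** * From coefficients to cardinalities *)

Lemma coef_sumX (T : Type) (l : seq T) (w : T -> nat) n :
  (\sum_(s <- l) 'X^(w s) : {poly rat})`_n
    = (size [seq s <- l | w s == n])%:R.
Proof.
rewrite coef_sum size_filter -sum1_count natr_sum [RHS]big_mkcond /=.
by apply: eq_bigr => s _; rewrite coefXn eq_sym; case: eqP.
Qed.

Lemma wgf11 M :
  wgf 1 1 'X M = \sum_(s <- level_le M) 'X^(sumn (map fst s)) :> {poly rat}.
Proof.
apply: eq_bigr => s _; elim: s => [|x s IH]; first by rewrite big_nil.
rewrite big_cons IH /= exprD; congr (_ * _).
by rewrite /letters !expr1n mulr1 !if_same mul1r.
Qed.

(** Replaces counting in a finite type of bounded sequences by the length of a list; the last
    hypothesis ensures that the bounds lose nothing. *)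
Lemma card_bseq (T : finType) (U : eqType) (f : T -> U) n (P : pred (seq U))
    (l : seq (seq U)) :
  injective f -> uniq l -> l =i P ->
  (forall s, P s -> (size s <= n)%N && all (mem (codom f)) s) ->
  #|[set s : n.-bseq T | P (map f s)]| = size l.
Proof.
move=> f_inj l_uniq lP P_bound.
rewrite cardE -(size_map (fun s : n.-bseq T => map f s)); apply/perm_size.
apply: uniq_perm => // [|s].
  rewrite map_inj_uniq ?enum_uniq // => s t /(inj_map f_inj) /val_inj.
  exact.
rewrite lP; apply/mapP/idP => [[t + ->]|Ps]; first by rewrite mem_enum inE.
have /andP[le_s /allP s_f] := P_bound s Ps.
have [t s_t] : exists t, s = map f t.
  elim: s s_f {Ps le_s} => [|x s IH] s_f; first by exists [::].
  have [|t ->] := IH; first by move=> y y_s; apply: s_f; rewrite inE y_s orbT.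
  have /codomP[y ->] := s_f x (mem_head _ _).
  by exists (y :: t).
rewrite s_t size_map in le_s; exists (Bseq le_s) => //.
by rewrite mem_enum inE /= -s_t.
Qed.

Lemma two_color_bound n s :
  is_two_color_partition n s ->
  (size s <= n)%N && all (fun x => (x.1 <= n) && (x.2 <= 2))%N s.
Proof.
case/and4P=> /is_partition_bound; rewrite size_map all_map.
case/andP=> -> le_n c _ _.
apply/allP => x x_s; have /= -> := allP le_n x x_s.
by case/orP: (allP c x x_s) => /eqP->.
Qed.

Lemma card_two_color n M : (n.+2 <= M)%N ->
  #|two_color_partitions n|
    = size [seq s <- level_le M | sumn (map fst s) == n].
Proof.
(* Reversal is needed because the enumeration lists the largest part first. The margin 2 in [le_nM]
   covers the level of a part [n] of color 2. *)
move=> le_nM; rewrite -(size_map rev).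
apply: (@card_bseq _ _ (fun x : 'I_n.+1 * 'I_3 => (val x.1, val x.2))).
- by move=> [x1 x2] [y1 y2] [/val_inj-> /val_inj->].
- by rewrite map_inj_uniq ?filter_uniq ?uniq_level_le //; apply: (can_inj revK).
- move=> s; rewrite -[s in LHS]revK mem_map; last exact: (can_inj revK).
  rewrite mem_filter mem_level_le /valid all_rev rev_sorted map_rev sumn_rev.
  rewrite unfold_in; apply/idP/idP => [|Ps].
    case/andP=> sum_s /andP[/andP[/allP v_s gap_s] _].
    rewrite /is_two_color_partition /is_partition sum_s all_map sorted_map andbT.
    have -> : sorted gap_ok s by [].
    apply/and3P; split; rewrite ?andbT; last by apply/allP => x /v_s /and3P[].
      apply/andP; split; last by apply/allP => x /v_s /and3P[].
      by apply: sub_sorted gap_s => x y /and4P[h _ _ _] /=; lia.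
    by apply/allP => x /v_s /and3P[].
  have /andP[_ /allP le_s] := two_color_bound Ps.
  case/and4P: Ps => /and3P[_ pos_s ->] /allP c_s /allP c2_s gap_s /=.
  apply/andP; split.
    apply/andP; split => //; apply/allP => x x_s.
    rewrite all_map in pos_s.
    have /= p := allP pos_s x x_s.
    by rewrite /valid_part p c_s // c2_s.
  case e : (rev s) => [|x t] //=.
  have /le_s/andP[] : x \in s by rewrite -mem_rev e mem_head.
  by rewrite /level; lia.
move=> s /two_color_bound /andP[-> /allP le_s]; apply/allP => -[m c] /le_s.
case/andP=> le_m le_c; apply/codomP.
by exists (Ordinal (le_m : m < n.+1)%N, Ordinal (le_c : c < 3)%N).
Qed.

Lemma card_pm1 n M : (n <= M)%N ->
  #|pm1_mod6_partitions n| = size [seq s <- pm1_le n M | sumn s == n].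
Proof.
move=> le_nM; rewrite -(size_map rev); apply: card_bseq.
- exact: val_inj.
- by rewrite map_inj_uniq ?filter_uniq ?uniq_pm1_le //; apply: (can_inj revK).
- move=> s; rewrite -[s in LHS]revK mem_map; last exact: (can_inj revK).
  rewrite mem_filter mem_pm1_le all_rev rev_sorted sumn_rev size_rev.
  rewrite unfold_in; apply/idP/idP => [|Ps].
    case/and5P=> sum_s _ pm_s sort_s _.
    rewrite /is_pm1_mod6_partition /is_partition sum_s pm_s !andbT.
    apply/andP; split=> //; apply: sub_all pm_s => m.
    by rewrite /congr_pm; lia.
  case/andP: Ps => part_s pm_s.
  have /andP[-> /allP le_s] := is_partition_bound part_s.
  case/and3P: part_s => sort_s _ ->; rewrite pm_s /=.
  apply/andP; split => //; case e : (rev s) => [|x t] //=.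
  by apply: leq_trans (le_s x _) le_nM; rewrite -mem_rev e mem_head.
move=> s /andP[/is_partition_bound/andP[-> /allP le_s] _].
apply/allP => m /le_s le_m; apply/codomP.
by exists (Ordinal (le_m : m < n.+1)%N).
Qed.

Local Close Scope ring_scope.

Theorem theorem3p1 (n : nat) (hn : 0 < n) :
  #|two_color_partitions n| = #|pm1_mod6_partitions n|.
Proof.
(* Taking [k = n + 1] makes congruence modulo ['X^k] determine the coefficient of degree [n]. *)
have le2 : (n.+2 <= 6 * n.+1 + 1)%N by lia.
have le1 : (n <= 6 * n.+1)%N by lia.
rewrite (card_two_color le2) (card_pm1 le1).
apply/eqP; rewrite -(Num.Theory.eqr_nat rat) -!coef_sumX -wgf11; apply/eqP.
apply: (@eqX_coef n.+1) => //; apply: eqX_trans (wgf_distinct _) _.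
(* Both sides are inverses of [pm1_prod] modulo ['X^(n+1)]. *)
apply: (eqX_cancel (pm1_prod_neq0 (6 * n.+1))).
apply: (@eqX_trans _ 1); last exact/eqX_sym/pm1_gf_prod.
by apply: eqX_leq (pm1_prod_distinct _); lia.
Qed.
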